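(* Let $X$ be an uncountable regular open Whyburn space. The following are equivalent: (1) $X$ satisfies $S_1(\Omega^s,\Gamma^s)$; (2) $X$ satisfies $S_1(\mathcal{K}_{\Omega},\mathcal{K}_{\Gamma})$; (3) $Q_p(X,\mathbb{R})$ is Fr\'{e}chet-Urysohn at the point $\mathbf{0}$; (4) $Q_p(X,\mathbb{R})$ is Fr\'{e}chet-Urysohn at the point $f$ for every continuous $f:X\to\mathbb{R}$; (5) $Q_p(X,\mathbb{D})$ is Fr\'{e}chet-Urysohn.
   Context: All spaces are assumed regular. A function $f:X\to Y$ is quasicontinuous if for every $x\in X$, every open $V\ni f(x)$ and every open $U\ni x$ there is a nonempty open $W\subseteq U$ with $f(W)\subseteq V$. $Q_p(X,Y)$ is the set of all quasicontinuous functions $X\to Y$ with the topology of pointwise convergence; $\mathbb{D}=\{0,1\}$ is discrete; $\mathbf{0}$ is the constant zero function. $X$ is open Whyburn if for every open $A\subseteq X$ and every $x\in\overline{A}\setminus A$ there is an open $B\subseteq A$ with $\overline{B}\setminus A=\{x\}$. A set $A$ is minimally bounded if $A\subseteq\overline{\mathrm{Int}A}$ and $\mathrm{Int}\overline{A}\subseteq A$. An $\omega$-cover of $X$ is a cover such that every finite subset of $X$ lies in some member; a $\gamma$-cover is a cover $\mathcal{U}$ such that for each $x\in X$ the set $\{U\in\mathcal{U}:x\notin U\}$ is finite. $\Omega^s$ (resp. $\Gamma^s$) is the collection of $\omega$-covers (resp. $\gamma$-covers) of $X$ by minimally bounded sets. $\mathcal{K}$ is the collection of families $\mathcal{U}$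 of open subsets of $X$ with $X=\bigcup\{\overline{U}:U\in\mathcal{U}\}$. $\mathcal{K}_\Omega$ is the set of $\mathcal{U}\in\mathcal{K}$ with no element dense in $X$ and such that for each finite $F\subseteq X$ some $U\in\mathcal{U}$ satisfies $F\subseteq\overline{U}$. $\mathcal{K}_\Gamma$ is the set of $\mathcal{U}\in\mathcal{K}$ with no element dense in $X$ and such that $\{\overline{U}:U\in\mathcal{U}\}$ is a $\gamma$-cover of $X$. $S_1(\mathcal{A},\mathcal{B})$: for every sequence $(A_n)_{n\in\mathbb{N}}$ of elements of $\mathcal{A}$ there are $b_n\in A_n$ with $\{b_n:n\in\mathbb{N}\}\in\mathcal{B}$. A space $Z$ is Fr\'{e}chet-Urysohn at $z$ if for every $A\subseteq Z$ with $z\in\overline{A}$ there is a sequence in $A$ converging to $z$; $Z$ is Fr\'{e}chet-Urysohn if it is so at every point. *)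

(* Defs.v *)
From HB Require Import structures.
From mathcomp Require Import all_boot all_order all_algebra.
From mathcomp Require Import all_classical all_reals all_analysis.
Set Implicit Arguments. Unset Strict Implicit. Unset Printing Implicit Defensive.
Import Order.TTheory GRing.Theory Num.Theory.
Import numFieldNormedType.Exports.
Local Open Scope classical_set_scope.

Definition quasicontinuous {X Y : topologicalType} (f : X -> Y) : Prop :=
  forall (x : X) (V : set Y) (U : set X), open V -> V (f x) -> open U -> U x ->
    exists W : set X, [/\ open W, W !=set0, W `<=` U & f @` W `<=` V].

Definition Qset (X Y : topologicalType) : set {ptws X -> Y} :=
  [set f | quasicontinuous (f : X -> Y)].
Arguments Qset : clear implicits.

(* Q_p(X,Y): quasicontinuous functions with the (subspace of the) topology of
   pointwise convergence; [set_type] carries the initial (subspace) topology *)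
Definition Qp (X Y : topologicalType) : topologicalType := set_type (Qset X Y).
Arguments Qp : clear implicits.

Definition frechet_urysohn_at {Z : topologicalType} (z : Z) : Prop :=
  forall A : set Z, closure A z ->
    exists u : nat -> Z, (forall n, A (u n)) /\ u @ \oo --> z.

Definition frechet_urysohn (Z : topologicalType) : Prop :=
  forall z : Z, frechet_urysohn_at z.

Definition open_whyburn (X : topologicalType) : Prop :=
  forall A : set X, open A -> forall x : X, closure A x -> ~ A x ->
    exists B : set X, [/\ open B, B `<=` A & closure B `\` A = [set x]].

Definition minimally_bounded {X : topologicalType} (A : set X) : Prop :=
  A `<=` closure (interior A) /\ interior (closure A) `<=` A.

Definition is_cover {X : Type} (C : set (set X)) : Prop :=
  \bigcup_(U in C) U = [set: X].

Definition omega_cover {X : Type} (C : set (set X)) : Prop :=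
  is_cover C /\ forall F : set X, finite_set F -> exists2 U, C U & F `<=` U.

Definition gamma_cover {X : Type} (C : set (set X)) : Prop :=
  is_cover C /\ forall x : X, finite_set [set U | C U /\ ~ U x].

Definition Omega_s (X : topologicalType) : set (set (set X)) :=
  [set C | omega_cover C /\ forall U, C U -> minimally_bounded U].
Definition Gamma_s (X : topologicalType) : set (set (set X)) :=
  [set C | gamma_cover C /\ forall U, C U -> minimally_bounded U].

Definition Kfam {X : topologicalType} (C : set (set X)) : Prop :=
  (forall U, C U -> open U) /\ \bigcup_(U in C) closure U = [set: X].

Definition no_dense {X : topologicalType} (C : set (set X)) : Prop :=
  forall U, C U -> closure U <> [set: X].

Definition K_Omega (X : topologicalType) : set (set (set X)) :=
  [set C | [/\ Kfam C, no_dense C &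
     forall F : set X, finite_set F -> exists2 U, C U & F `<=` closure U]].

Definition K_Gamma (X : topologicalType) : set (set (set X)) :=
  [set C | [/\ Kfam C, no_dense C & gamma_cover (closure @` C)]].

Definition S1 {T : Type} (A B : set (set (set T))) : Prop :=
  forall s : nat -> set (set T), (forall n, A (s n)) ->
    exists b : nat -> set T, (forall n, s n (b n)) /\ B (range b).
Arguments Omega_s : clear implicits.
Arguments Gamma_s : clear implicits.
Arguments K_Omega : clear implicits.
Arguments K_Gamma : clear implicits.

(* Main.v *)
(* Every condition is equivalent to [gamma_subfamilies X]: each family of
   minimally bounded sets, one containing any given finite set, has a sequence
   whose members eventually contain every point.

   The indicator of A is quasicontinuous exactly when A is minimally bounded, so
   the Frechet-Urysohn property at a constant gives this property; (1) and (2)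
   give it too once the members of the n-th family are made to contain x_i for
   i < n and to miss some x_m, where (x_n) is an injective sequence. For (2) the
   open Whyburn property shrinks a minimally bounded set to an open one whose
   closure adds only finitely many points.

   Conversely, the property makes all boundaries of minimally bounded sets
   countable (by the open Whyburn property), and every countable union D of such
   boundaries has open P_j, containing the j-th stage of an exhaustion of D by
   finite sets, such that each point off D leaves the closures of the P_j
   eventually: a point of D is in the closure of both sides of a boundary, so its
   neighbourhoods can be shrunk on one side at a time. Points of D are then
   treated as a sequence of finite conditions; off D, interiors of finitely many
   minimally bounded sets can be intersected, which gives the selection of one
   member from each of countably many families, and indicators can be compared
   with a given one, which gives (5). *)
Require Import Defs.
From HB Require Import structures.
From mathcomp Require Import all_boot all_order all_algebra.
From mathcomp Require Import all_classical all_reals all_analysis.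
Import Order.TTheory GRing.Theory Num.Theory.
Import numFieldNormedType.Exports.
Local Open Scope classical_set_scope.
Local Open Scope ring_scope.
Set Implicit Arguments. Unset Strict Implicit. Unset Printing Implicit Defensive.

(** * The topology of pointwise convergence on [Qp] *)

Lemma Qp_cvg_filter (X Y : topologicalType) (G : set_system (Qp X Y))
    (z : Qp X Y) : Filter G ->
  G --> z <-> forall x, (fun a : Qp X Y => (set_val a : X -> Y) x) @ G -->
                (set_val z : X -> Y) x.
Proof.
move=> FG; split=> [Gz x|Gz].
  have ce : continuous (fun a : Qp X Y => (set_val a : X -> Y) x).
    have cv : continuous (set_val : Qp X Y -> {ptws X -> Y}).
      exact: initial_continuous.
    have cp : continuous (fun f : {ptws X -> Y} => (f : X -> Y) x).
      exact: (@proj_continuous X (fun=> Y) x).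
    by move=> a; exact: (continuous_comp (cv a) (cp (set_val a))).
  apply: cvg_trans (ce z); exact: cvg_app.
have evz : set_val @ G --> (set_val z : {ptws X -> Y}).
  apply/cvg_sup => x N [_ [[W oW <-] Wz] WN].
  by apply: filterS WN _; apply: (Gz x); exact: open_nbhs_nbhs.
move=> N; rewrite nbhsE => -[_ [[W oW <-] Wz] WN].
by apply: filterS WN _; apply: evz; exact: open_nbhs_nbhs.
Qed.

Lemma Qp_cvgP (X Y : topologicalType) (u : nat -> Qp X Y) (z : Qp X Y) :
  u @ \oo --> z <-> forall x, (fun n => (set_val (u n) : X -> Y) x) @ \oo -->
    (set_val z : X -> Y) x.
Proof. exact: Qp_cvg_filter. Qed.

Lemma Qp_closureP (X Y : topologicalType) (A : set (Qp X Y)) (z : Qp X Y) :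
  closure A z <-> forall (F : set X) (V : X -> set Y), finite_set F ->
    (forall x, nbhs ((set_val z : X -> Y) x) (V x)) ->
    exists2 a, A a & forall x, F x -> V x ((set_val a : X -> Y) x).
Proof.
split=> [clA F V finF nV|happ N nN].
  have nN : nbhs z [set a : Qp X Y | forall x, F x -> V x ((set_val a : X -> Y) x)].
    pose h x := [set a : Qp X Y | V x ((set_val a : X -> Y) x)].
    have -> : [set a : Qp X Y | forall x, F x -> V x ((set_val a : X -> Y) x)] =
        \bigcap_(x in F) h x by [].
    have /finite_fsetP[F' ->] := finF.
    apply: filter_bigI => x _; rewrite /h.
    have /Qp_cvg_filter/(_ x) : nbhs z --> z by [].
    by apply; exact: nV.
  by have [a [Aa Na]] := clA _ nN; exists a.
(* [G] is the filter generated by the basic pointwise neighbourhoods of [z]. It converges to [z], so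
   every neighbourhood of [z] contains a basic one. *)
pose G : set_system (Qp X Y) := [set N | exists F : set X, exists V : X -> set Y,
  [/\ finite_set F, forall x, nbhs ((set_val z : X -> Y) x) (V x) &
    forall a : Qp X Y, (forall x, F x -> V x ((set_val a : X -> Y) x)) -> N a]].
have FG : Filter G.
  split.
  - by exists set0, (fun=> setT); split=> // x; exact: filterT.
  - move=> P Q [F [V [fF nV VP]]] [F' [V' [fF' nV' VQ]]].
    exists (F `|` F'), (fun x => V x `&` V' x); split.
    + by rewrite finite_setU.
    + by move=> x; exact: filterI.
    + move=> a FV; split.
        by apply: VP => x Fx; have [] := FV x (or_introl Fx).
      by apply: VQ => x Fx; have [] := FV x (or_intror Fx).
  - move=> P Q PQ [F [V [fF nV VP]]]; exists F, V; split=> // a /VP; exact: PQ.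
have Gz : G --> z.
  apply/Qp_cvg_filter => x N' nN'; exists [set x], (fun y => [set t | y = x -> N' t]).
  split=> //; last by move=> a /(_ x erefl) /=; exact.
  move=> y; have [->|yx] := pselect (y = x).
    by apply: filterS nN' => t N't.
  by apply: filterS filterT => t _ /yx.
have [F [V [fF nV VN]]] := Gz _ nN.
by have [a Aa /VN Na] := happ F V fF nV; exists a.
Qed.

(** * Closures, interiors and minimally bounded sets *)

Lemma closure_openP (X : topologicalType) (A : set X) (x : X) :
  closure A x <-> forall O, open O -> O x -> exists2 y, A y & O y.
Proof.
split=> [clA O oO Ox|h B].
  by have [y [Ay Oy]] := clA O (open_nbhs_nbhs (conj oO Ox)); exists y.
rewrite nbhsE => -[Q [oQ Qx] QB]; have [y Ay Qy] := h Q oQ Qx.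
by exists y; split=> //; exact: QB.
Qed.

Lemma sub_interior (X : topologicalType) (G A : set X) :
  open G -> G `<=` A -> G `<=` interior A.
Proof. by move=> oG GA; rewrite -open_subsetE. Qed.

Lemma open_closure_disjoint (X : topologicalType) (A G : set X) (x : X) :
  open G -> (forall y, A y -> ~ G y) -> closure A x -> ~ G x.
Proof. by move=> oG AG /closure_openP clA Gx; have [y /AG] := clA G oG Gx. Qed.

Lemma closure_min (X : topologicalType) (A C : set X) :
  closed C -> A `<=` C -> closure A `<=` C.
Proof. by move=> cC /closureS AC; rewrite [C](closure_id _).1. Qed.

(** Complementation turns the second half of the definition into the first half for the complement,
    a form symmetric in the two sides. *)
Lemma minimally_boundedP (X : topologicalType) (A : set X) :
  minimally_bounded A <->
  A `<=` closure (interior A) /\ ~` A `<=` closure (interior (~` A)).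
Proof.
rewrite interiorC closure_setC.
by split=> -[A1 A2]; split=> //; apply/subsetCP.
Qed.

Lemma minimally_boundedC (X : topologicalType) (A : set X) :
  minimally_bounded A -> minimally_bounded (~` A).
Proof. by move=> /minimally_boundedP[? ?]; apply/minimally_boundedP; rewrite setCK. Qed.

Lemma minimally_bounded_halves (X : topologicalType) (A G H : set X) :
  open G -> open H -> G `<=` A -> H `<=` ~` A ->
  A `<=` closure G -> ~` A `<=` closure H -> minimally_bounded A.
Proof.
move=> oG oH GA HA AG AH; apply/minimally_boundedP; split.
  by apply: (subset_trans AG); apply: closureS; exact: sub_interior.
by apply: (subset_trans AH); apply: closureS; exact: sub_interior.
Qed.

Lemma minimally_bounded_closure (X : topologicalType) (G : set X) :
  open G -> minimally_bounded (closure G).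
Proof.
move=> oG; split; first by apply: closureS; exact: sub_interior oG (@subset_closure _ G).
by apply: (subset_trans (@interior_subset _ _)); apply: closure_min => //; exact: closed_closure.
Qed.

(** Adding [interior (closure E)] leaves the closure unchanged, so the interior of the new closure
    is already inside. *)
Lemma minimally_bounded_regularize (X : topologicalType) (E : set X) :
  E `<=` closure (interior E) -> minimally_bounded (E `|` interior (closure E)).
Proof.
move=> EE; have oI : open (interior (closure E)) by exact: open_interior.
have IE : interior E `<=` interior (closure E).
  by apply: interiorS; exact: subset_closure.
split.
  have J : interior (closure E) `<=` interior (E `|` interior (closure E)).
    by apply: sub_interior => // x; right.
  apply: (@subset_trans _ (closure (interior (closure E)))); last exact: closureS.
  by move=> x [/EE|/subset_closure//]; exact: closureS.
apply: (@subset_trans _ (interior (closure E))); last by right.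
apply: interiorS; apply: closure_min; first exact: closed_closure.
by move=> x [/subset_closure//|/interior_subset].
Qed.

Lemma minimally_boundedD (X : topologicalType) (A O : set X) :
  open O -> minimally_bounded A -> minimally_bounded (A `\` closure O).
Proof.
move=> oO /minimally_boundedP[A1 A2].
apply: (@minimally_bounded_halves _ _ (interior A `\` closure O)
  (interior (~` A) `|` O)).
- apply: openI; [exact: open_interior|by rewrite openC; exact: closed_closure].
- by apply: openU => //; exact: open_interior.
- by move=> x [/interior_subset].
- move=> x [/interior_subset /= nAx [] //|Ox [_ ]]; apply; exact: subset_closure.
- move=> x [/A1 /closure_openP Ax Ox]; apply/closure_openP => W oW Wx.
  have [||y Ay [Wy Oy]] := Ax (W `\` closure O).
  + by apply: openI => //; rewrite openC; exact: closed_closure.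
  + by [].
  + by exists y.
- move=> x /not_andP[/A2|/contrapT]; first by apply: closureS => y; left.
  by apply: closureS => y; right.
Qed.

Lemma minimally_bounded_indicator (X : topologicalType) (A : set X) :
  minimally_bounded A <-> quasicontinuous (fun x => x \in A : bool).
Proof.
split=> [/minimally_boundedP[A1 A2] x V U _ Vx oU Ux|q].
  have [Ax|Ax] := pselect (A x).
    exists (U `&` interior A); split.
    - by apply: openI => //; exact: open_interior.
    - by have /closure_openP/(_ U oU Ux)[y ? ?] := A1 _ Ax; exists y.
    - by move=> y [].
    - move=> _ [y [_ /interior_subset Ay] <-].
      by move: Vx; rewrite !mem_set.
  exists (U `&` interior (~` A)); split.
  - by apply: openI => //; exact: open_interior.
  - by have /closure_openP/(_ U oU Ux)[y ? ?] := A2 _ Ax; exists y.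
  - by move=> y [].
  - move=> _ [y [_ /interior_subset Ay] <-].
    by move: Vx; rewrite !memNset.
have ob (b : bool) : open [set b] by exact: discrete_open.
apply/minimally_boundedP; split=> x Ax; apply/closure_openP => O oO Ox.
  have [|W [oW [y Wy] WO WV]] := q x [set true] O (ob _) _ oO Ox.
    by rewrite /= mem_set.
  exists y; last exact: WO.
  apply: (sub_interior oW) => // z Wz.
  have : (z \in A) = true by apply: (WV (z \in A)); exists z.
  exact: set_mem.
have [|W [oW [y Wy] WO WV]] := q x [set false] O (ob _) _ oO Ox.
  by rewrite /= memNset.
exists y; last exact: WO.
apply: (sub_interior oW) => // z Wz Az.
have : (z \in A) = false by apply: (WV (z \in A)); exists z.
by rewrite mem_set.
Qed.

(** * Regularity, eventual properties and exhaustions by finite sets *)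

Lemma regular_open (X : topologicalType) (U : set X) (x : X) :
  regular_space X -> open U -> U x ->
  exists V, [/\ open V, V x & closure V `<=` U].
Proof.
move=> Xreg oU Ux; have [V nV VU] := Xreg x U (open_nbhs_nbhs (conj oU Ux)).
exists (interior V); split; [exact: open_interior|by []|].
by apply: subset_trans VU; apply: closureS; exact: interior_subset.
Qed.

Lemma regular_open_finite (X : topologicalType) (F : set X) (x : X) :
  regular_space X -> accessible_space X -> finite_set F -> ~ F x ->
  exists V, [/\ open V, V x & forall y, F y -> ~ closure V y].
Proof.
move=> Xreg XT1 finF Fx.
have oF : open (~` F) by rewrite openC; exact: accessible_finite_set_closed.1.
have [V [oV Vx VF]] := regular_open Xreg oF Fx.
by exists V; split=> // y Fy /VF.
Qed.

Definition finitely_covers (X : Type) (C : set (set X)) : Prop :=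
  forall F : set X, finite_set F -> exists2 U, C U & F `<=` U.

Definition converges_to_total (X : Type) (b : nat -> set X) : Prop :=
  forall x, exists N, forall n, (N <= n)%N -> b n x.

Definition gamma_subfamilies (X : topologicalType) : Prop :=
  forall C : set (set X), C `<=` minimally_bounded -> finitely_covers C ->
    exists b, (forall n, C (b n)) /\ converges_to_total b.

Definition gamma_selections (X : topologicalType) : Prop :=
  forall C : nat -> set (set X),
    (forall n, C n `<=` minimally_bounded) -> (forall n, finitely_covers (C n)) ->
    exists b, (forall n, C n (b n)) /\ converges_to_total b.

Lemma finite_eventually (T : Type) (F : set T) (P : nat -> T -> Prop) :
  finite_set F ->
  (forall y, F y -> exists N, forall n, (N <= n)%N -> P n y) ->
  exists N, forall n, (N <= n)%N -> forall y, F y -> P n y.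
Proof.
move=> finF hP.
have /choice[f fP] : forall y, exists N, F y -> forall n, (N <= n)%N -> P n y.
  move=> y; have [/hP[N NP]|nF] := pselect (F y); first by exists N.
  by exists 0%N => /nF.
have /finite_seqP[s fs] : finite_set (f @` F) by exact: finite_image.
exists (\max_(i <- s) i)%N => n sn y Fy.
apply: fP => //; apply: leq_trans sn.
have fys : f y \in s by have : (f @` F) (f y) by [exists y]; rewrite fs.
exact: (@leq_bigmax_seq _ s xpredT id).
Qed.

Lemma injective_avoids (T : Type) (x : nat -> T) (F : set T) :
  injective x -> finite_set F ->
  exists N, forall n, (N <= n)%N -> ~ F (x n).
Proof.
move=> injx finF.
have [y _|N NP] := @finite_eventually _ F (fun n y => x n <> y) finF.
  have [[m xm]|nx] := pselect (exists m, x m = y).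
    exists m.+1 => n mn xn; move: mn; rewrite -xm in xn.
    by rewrite (injx _ _ xn) ltnn.
  by exists 0%N => n _ xn; apply: nx; exists n.
by exists N => n Nn Fxn; exact: (NP n Nn _ Fxn).
Qed.

Definition exhaustion (T : Type) (D : set T) (S : nat -> set T) : Prop :=
  [/\ forall j, finite_set (S j), forall i j, (i <= j)%N -> S i `<=` S j &
    \bigcup_j S j = D].

Lemma countable_exhaustion (T : Type) (D : set T) :
  countable D -> exists S, exhaustion D S.
Proof.
move=> /countable_injP[f injf].
exists (fun j => [set d | D d /\ (f d <= j)%N]); split.
- move=> j; set A := [set _ | _].
  have injA : {in A &, injective f}.
    by move=> a b /set_mem[Da _] /set_mem[Db _]; apply: injf; exact: mem_set.
  rewrite -(eq_finite_set (inj_card_eq injA)).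
  apply: (@sub_finite_set _ _ `I_j.+1); last exact: finite_II.
  by move=> _ [d [_ dj] <-].
- by move=> i j ij d [Dd di]; split=> //; exact: leq_trans ij.
- by apply/seteqP; split=> [d [j _ []]//|d Dd]; exists (f d).
Qed.

Lemma exhaustion_sub (T : Type) (D : set T) (S : nat -> set T) j :
  exhaustion D S -> S j `<=` D.
Proof. by move=> [_ _ <-] y Sy; exists j. Qed.

Lemma exhaustion_eventually (T : Type) (D F : set T) (S : nat -> set T) :
  exhaustion D S -> finite_set F -> F `<=` D ->
  exists N, forall n, (N <= n)%N -> F `<=` S n.
Proof.
move=> [_ mS SD] finF FD.
have [y /FD|N NP] := @finite_eventually _ F S finF.
  by rewrite -SD => -[N _ SN]; exists N => n /mS; exact.
by exists N => n /NP.
Qed.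

Lemma infinite_sequence (T : Type) :
  ~ countable [set: T] -> exists x : nat -> T, injective x.
Proof.
elim/Ppointed: T => T; first by rewrite emptyE => /(_ (countable0 T)).
move=> ncT; have /infiniteP/pcard_injP[f injf] : infinite_set [set: T].
  by move=> /finite_set_countable.
by exists f => a b; apply: injf; rewrite in_setT.
Qed.

(* Removing a neighbourhood of x n from the members of Z n forces the indices
   of the chosen members to infinity. *)
Lemma gamma_subfamilies_diagonal (X : topologicalType) (x : nat -> X)
    (Z : nat -> set (set X)) :
  regular_space X -> accessible_space X ->
  gamma_subfamilies X -> injective x -> (forall n, Z n `<=` minimally_bounded) ->
  (forall F N, finite_set F -> exists n, (N <= n)%N /\ exists2 U, Z n U & F `<=` U) ->
  exists (n : nat -> nat) (b : nat -> set X),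
    [/\ forall r, (r <= n r)%N, forall r, Z (n r) (b r) & converges_to_total b].
Proof.
move=> Xreg XT1 subX injx Zmb Zcov.
pose C := [set U | exists n A O, [/\ Z n A, open O, O (x n) & U = A `\` closure O]].
have [||b [Cb bcv]] := subX C.
- by move=> _ [n [A [ O [ZA oO _ ->]]]]; apply: minimally_boundedD => //; exact: Zmb ZA.
- move=> F finF; have [N Nx] := injective_avoids injx finF.
  have [n [Nn [A ZA FA]]] := Zcov F N finF.
  have [ O [oO Oxn OF]] := regular_open_finite Xreg XT1 finF (Nx n Nn).
  exists (A `\` closure O); first by exists n, A, O.
  by move=> y Fy; split; [exact: FA|exact: OF].
have /choice[m mP] := Cb.
have /choice[A AP] := mP.
(* For each [i < k] the point [x i] lies in [b r] for large [r], whereas [b r] omits [x (m r)]. *)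
have mlarge k : exists N, forall r, (N <= r)%N -> (k <= m r)%N.
  have [i _|N NP] := @finite_eventually _ `I_k (fun r i => b r (x i)) (finite_II _).
    exact: bcv.
  exists N => r Nr; rewrite leqNgt; apply/negP => mrk.
  have [ O [_ _ Omr bE]] := AP r.
  have : b r (x (m r)) by exact: NP.
  by rewrite bE => -[_]; apply; exact: subset_closure.
have /choice[f fP] : forall k, exists r, (k <= r)%N /\ (k <= m r)%N.
  move=> k; have [N NP] := mlarge k; exists (maxn k N).
  by rewrite leq_maxl NP ?leq_maxr.
exists (m \o f), (A \o f); split => /=.
- by move=> r; have [] := fP r.
- by move=> r; have [ O []] := AP (f r).
- move=> y; have [N NP] := bcv y; exists N => n Nn /=.
  have [ O [_ _ _ bE]] := AP (f n).
  have : b (f n) y by apply: NP; apply: leq_trans Nn _; have [] := fP n.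
  by rewrite bE => -[].
Qed.

(** * Countability of boundaries *)

Definition boundary (X : topologicalType) (A : set X) : set X :=
  closure A `\` interior A.

(** One open set is taken per point of [F]: regularity provides it at a point of [A], the open
    Whyburn property at any other point. Closure commutes with their finite union. *)
Lemma open_whyburn_finite (X : topologicalType) (A F : set X) :
  regular_space X -> open_whyburn X -> open A -> finite_set F ->
  F `<=` closure A ->
  exists V, [/\ open V, V `<=` A, F `<=` closure V & closure V `<=` A `|` F].
Proof.
move=> Xreg Xow oA finF FA.
have /choice[B BP] : forall x, exists B, F x ->
    [/\ open B, B `<=` A, closure B x & closure B `<=` A `|` [set x]].
  move=> x; have [Fx|nF] := pselect (F x); last by exists setT.
  have [Ax|nAx] := pselect (A x).
    have [V [oV Vx VA]] := regular_open Xreg oA Ax; exists V => _; split=> //.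
    - by apply: subset_trans VA; exact: subset_closure.
    - exact: subset_closure.
    - by move=> y /VA; left.
  have [B [oB BA Bx]] := Xow A oA x (FA x Fx) nAx; exists B => _; split=> //.
    by have : [set x] x by []; rewrite -Bx => -[].
  move=> y By; have [Ay|nAy] := pselect (A y); first by left.
  by right; rewrite -Bx.
exists (\bigcup_(x in F) B x); split.
- by apply: bigcup_open => x /BP[].
- by move=> y [x /BP[_ + _ _]]; apply.
- move=> x Fx; have [_ _ + _] := BP x Fx; apply: closureS.
  exact: bigcup_sup.
- apply: (@subset_trans _ (\bigcup_(x in F) closure (B x))).
    apply: closure_min; first by apply: closed_bigcup => // x _; exact: closed_closure.
    by move=> y [x Fx /subset_closure By]; exists x.
  move=> y [x Fx By]; have [_ _ _ /(_ _ By)] := BP x Fx.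
  by move=> [|->]; [left|right].
Qed.

(** Every finite set lies in a minimally bounded set that meets [D] in finitely many points. A
    sequence of such sets eventually containing every point makes [D] a countable union of finite
    sets. *)
Lemma countable_closureD (X : topologicalType) (A : set X) :
  regular_space X -> open_whyburn X -> gamma_subfamilies X -> open A ->
  countable (closure A `\` A).
Proof.
move=> Xreg Xow subX oA; set D := closure A `\` A.
have [||b [Cb bcv]] := subX [set Z | minimally_bounded Z /\ finite_set (Z `&` D)].
- by move=> Z [].
- move=> F finF.
  have fF1 : finite_set (F `&` closure A) by exact: finite_setIl.
  have [V [oV VA FV VAF]] := open_whyburn_finite Xreg Xow oA fF1 (@subIsetr _ _ _).
  have oE : open (~` closure A) by rewrite openC; exact: closed_closure.
  (* [closure V] adds to [A] only points of [F], and the complement of [closure A] misses [D], so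
     this set meets [D] only inside [F]. *)
  exists (closure V `|` ~` closure A); last first.
    by move=> y Fy; have [cy|cy] := pselect (closure A y); [left; exact: FV|right].
  split; last first.
    apply: (@sub_finite_set _ _ F) => // y [[/VAF[|[]//]|]] + [] //.
  apply: (@minimally_bounded_halves _ _ (V `|` ~` closure A) (A `\` closure V)).
  + exact: openU.
  + by apply: openI => //; rewrite openC; exact: closed_closure.
  + by move=> y [/subset_closure|]; [left|right].
  + by move=> y [/subset_closure Ay Vy] [].
  + move=> y [|Ey]; first by apply: closureS => z; left.
    by apply: subset_closure; right.
  + move=> y /not_orP[nVy /contrapT /closure_openP Ay]; apply/closure_openP => W oW Wy.
    have [||z Az [Wz Vz]] := Ay (W `\` closure V).
    * by apply: openI => //; rewrite openC; exact: closed_closure.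
    * by [].
    * by exists z.
apply: (@sub_countable _ _ _ (\bigcup_n (b n `&` D))).
  apply: subset_card_le => y Dy; have [N /(_ N (leqnn N)) bN] := bcv y.
  by exists N.
apply: bigcup_countable => // n _; apply: finite_set_countable.
by have [] := Cb n.
Qed.

Lemma countable_boundary (X : topologicalType) (A : set X) :
  regular_space X -> open_whyburn X -> gamma_subfamilies X ->
  minimally_bounded A -> countable (boundary A).
Proof.
move=> Xreg Xow subX [A1 _].
apply: sub_countable (countable_closureD Xreg Xow subX (@open_interior _ A)).
apply: subset_card_le => x [clA nA]; split=> //.
by apply: closure_min clA => //; exact: closed_closure.
Qed.

(** * Neighbourhoods receding from the points off a countable union of boundaries *)

(** A point [d] may lie in the closure of the part of [Q j d] in [H d] for every choice of [Q], so
    [K j Q] is removed from the space and the finite set [S j] is put back. The result is minimally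
    bounded since each [d] is also approached from [G d], which is disjoint from [H d]. *)
Lemma shrinking_half_neighbourhoods (X : topologicalType) (x : nat -> X)
    (D : set X) (S : nat -> set X) (G H : X -> set X) :
  regular_space X -> accessible_space X -> gamma_subfamilies X -> injective x ->
  exhaustion D S ->
  (forall d, open (G d)) -> (forall d, open (H d)) ->
  (forall d y, G d y -> ~ H d y) -> (forall d, D d -> closure (G d) d) ->
  exists Q : nat -> X -> set X,
    (forall j d, S j d -> open (Q j d) /\ Q j d d) /\
    (forall y, ~ D y -> exists N, forall j, (N <= j)%N -> forall d, S j d ->
      ~ closure (Q j d `&` H d) y).
Proof.
move=> Xreg XT1 subX injx exS oG oH GH GD.
have SD j : S j `<=` D by exact: exhaustion_sub exS.
have [finS mS _] := exS.
pose K j (Q : X -> set X) := \bigcup_(d in S j) closure (Q d `&` H d).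
have cK j Q : closed (K j Q).
  by apply: closed_bigcup => // d _; exact: closed_closure.
pose Z j := [set A | exists2 Q : X -> set X, (forall d, S j d ->
    [/\ open (Q d), Q d d & forall e, S j e -> e <> d -> ~ closure (Q d) e]) &
  A = ~` K j Q `|` S j].
have [||n [b [nr Zb bcv]]] := gamma_subfamilies_diagonal (Z := Z) Xreg XT1 subX injx.
- move=> j _ [Q QP ->].
  apply: (@minimally_bounded_halves _ _ (~` K j Q)
    (\bigcup_(d in S j) (Q d `&` H d))).
  + by rewrite openC.
  + by apply: bigcup_open => d /QP[oQ _ _]; exact: openI.
  + by left.
  + move=> y [d Sd [Qy Hy]] [nK|Sy].
      by apply: nK; exists d => //; exact: subset_closure.
    have [yd|yd] := pselect (y = d).
      apply: (open_closure_disjoint (oH d) (GH d) (GD _ (SD _ _ Sd))).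
      by rewrite -{2}yd.
    have [_ _ /(_ y Sy yd)] := QP d Sd; apply; exact: subset_closure.
  + move=> y [/subset_closure//|Sy]; apply/closure_openP => W oW Wy.
    (* Off [M], a point of [K j Q] can only come from the index [y], and the closure taken there
       misses the open set [G y]. So points of [G y] off [M] approach [y] outside [K j Q]. *)
    pose M := \bigcup_(d in S j `\ y) closure (Q d).
    have cM : closed M.
      by apply: closed_bigcup => [|d _]; [exact: finite_setD|exact: closed_closure].
    have nMy : ~ M y.
      move=> [d [Sd dy] Qdy]; have [_ _ /(_ y Sy)] := QP d Sd; apply=> // yd.
      exact: dy.
    have /closure_openP/(_ (W `\` M)) [||z Gz [Wz Mz]] := GD _ (SD _ _ Sy).
    * by apply: openI => //; rewrite openC.
    * by [].
    exists z => // -[d Sd Kz]; have [dy|dy] := pselect (d = y).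
      move: Kz; rewrite dy => /(open_closure_disjoint (oG y)); apply=> // t [_ Ht] Gt.
      exact: (GH y t).
    by apply: Mz; exists d => //; apply: closureS Kz => t [].
  + move=> y /not_orP[/contrapT [d Sd Ky] _]; apply: closureS Ky.
    by move=> t Qt; exists d.
- move=> F N finF.
  exists N; split=> //.
  (* The closure of [Q d] avoids every other point of [F] and [S N], so [K N Q] contains no point of
     [F] outside [S N]. *)
  have /choice[Q QP] : forall d, exists V, [/\ open V, V d &
      forall y, ((F `|` S N) `\ d) y -> ~ closure V y].
    move=> d; have fF : finite_set ((F `|` S N) `\ d).
      by apply: finite_setD; rewrite finite_setU.
    by apply: (regular_open_finite Xreg XT1 fF) => -[_]; apply.
  exists (~` K N Q `|` S N).
    exists Q => // d Sd; have [oQ Qd QF] := QP d; split=> // e Se ed.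
    by apply: QF; split=> //; right.
  move=> y Fy; have [Sy|nSy] := pselect (S N y); [by right|left].
  move=> [d Sd Ky]; have [_ _ QF] := QP d; apply: (QF y).
    by split; [left|move=> yd; apply: nSy; rewrite yd].
  by apply: closureS Ky => t [].
have /choice[Q QP] : forall r, exists Q : X -> set X, (forall d, S (n r) d ->
    [/\ open (Q d), Q d d & forall e, S (n r) e -> e <> d -> ~ closure (Q d) e]) /\
  b r = ~` K (n r) Q `|` S (n r).
  by move=> r; have [Q ? ?] := Zb r; exists Q.
(* The choice made for stage [n r] serves stage [r], because [r <= n r] and [S] is increasing. *)
exists (fun r => Q r); split=> [j d Sd|y nDy].
  have [/(_ d)[]//] := QP j; exact: mS (nr j) _ Sd.
have [N NP] := bcv y; exists N => j Nj d Sd Qy.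
have [_ bE] := QP j; have := NP j Nj; rewrite bE => -[|/SD//]; apply.
by exists d => //; exact: mS (nr j) _ Sd.
Qed.


(** The interiors of [A] and of its complement have dense union, hence one that is dense in the open
    set [Q]. *)
Lemma closure_off_boundary (X : topologicalType) (A Q : set X) :
  minimally_bounded A -> open Q ->
  closure Q `<=` closure (Q `&` interior A) `|` closure (Q `&` interior (~` A)).
Proof.
move=> /minimally_boundedP[A1 A2] oQ; rewrite -closureU => y /closure_openP Qy.
apply/closure_openP => W oW Wy; have [z Qz Wz] := Qy W oW Wy.
have oQW : open (Q `&` W) by exact: openI.
have [/A1/closure_openP/(_ _ oQW (conj Qz Wz))|] := pselect (A z).
  by move=> [t At [Qt Wt]]; exists t => //; left.
by move=> /A2/closure_openP/(_ _ oQW (conj Qz Wz))[t At [Qt Wt]]; exists t => //; right.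
Qed.

Lemma off_boundary (X : topologicalType) (A : set X) (y : X) :
  ~ boundary A y -> interior A y \/ interior (~` A) y.
Proof. by move=> /not_andP[|/contrapT]; [rewrite interiorC; right|left]. Qed.

(** The two sides of a boundary through [d] are shrunk separately. After intersecting, both halves
    of the neighbourhood recede from a point off [D], and by [closure_off_boundary] the halves
    account for its whole closure. *)
Lemma vanishing_neighbourhoods (X : topologicalType) (x : nat -> X)
    (D : set X) (S : nat -> set X) :
  regular_space X -> accessible_space X -> gamma_subfamilies X -> injective x ->
  exhaustion D S ->
  (forall d, D d -> exists2 A, minimally_bounded A & boundary A d) ->
  exists P : nat -> set X, [/\ forall j, open (P j), forall j, S j `<=` P j &
    forall y, ~ D y -> exists N, forall j, (N <= j)%N -> ~ closure (P j) y].
Proof.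
move=> Xreg XT1 subX injx exS Dbd.
have /choice[A AP] : forall d, exists A, D d -> minimally_bounded A /\ boundary A d.
  move=> d; have [/Dbd[A ? ?]|nD] := pselect (D d); first by exists A.
  by exists setT.
have dis d y : interior (A d) y -> ~ interior (~` A d) y.
  by move=> /interior_subset ? /interior_subset.
have cG d : D d -> closure (interior (A d)) d.
  move=> /AP[[A1 _] [Ad _]]; apply: closure_min Ad => //; exact: closed_closure.
have cH d : D d -> closure (interior (~` A d)) d.
  move=> /AP[/minimally_boundedP[_ A2] [_ Ad]].
  have : closure (~` A d) d by rewrite closure_setC.
  by apply: closure_min => //; exact: closed_closure.
have [Q [Q1 Q2]] := @shrinking_half_neighbourhoods _ _ D S (fun d => interior (A d))
  (fun d => interior (~` A d)) Xreg XT1 subX injx exS (fun=> open_interior _)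
  (fun=> open_interior _) dis cG.
have [Q' [Q'1 Q'2]] := @shrinking_half_neighbourhoods _ _ D S
  (fun d => interior (~` A d)) (fun d => interior (A d)) Xreg XT1 subX injx exS
  (fun=> open_interior _) (fun=> open_interior _) (fun d y p q => dis d y q p) cH.
have [finS mS _] := exS.
exists (fun j => \bigcup_(d in S j) (Q j d `&` Q' j d)); split.
- move=> j; apply: bigcup_open => d Sd.
  by apply: openI; [have [] := Q1 j d Sd|have [] := Q'1 j d Sd].
- move=> j d Sd; exists d => //.
  by split; [have [] := Q1 j d Sd|have [] := Q'1 j d Sd].
- move=> y nDy; have [N NP] := Q2 y nDy; have [N' N'P] := Q'2 y nDy.
  exists (maxn N N') => j; rewrite geq_max => /andP[Nj N'j] Py.
  have [d Sd Qy] : (\bigcup_(d in S j) closure (Q j d `&` Q' j d)) y.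
    apply: closure_min Py.
      by apply: closed_bigcup => // d _; exact: closed_closure.
    by move=> z [d Sd /subset_closure Qz]; exists d.
  have [oQ _] := Q1 j d Sd; have [oQ' _] := Q'1 j d Sd.
  have [Ad _] := AP d (exhaustion_sub exS Sd).
  have [|] := closure_off_boundary Ad (openI oQ oQ') Qy.
    move=> h; apply: (N'P j N'j d Sd); apply: closureS h.
    by move=> z [[_ ? ] ?].
  move=> h; apply: (NP j Nj d Sd); apply: closureS h.
  by move=> z [[? _ ] ?].
Qed.

(** * Selections from countably many families and convergence to a given set *)

(** Each family first yields a sequence [U i k], and at stage [n] one index [k] serves all families
    up to [n]. Intersections of minimally bounded sets need not be minimally bounded, so only
    interiors are intersected, and [P n] takes care of the points of [D]. *)
Lemma gamma_subfamilies_selections (X : topologicalType) (x : nat -> X) :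
  regular_space X -> accessible_space X -> open_whyburn X -> injective x ->
  gamma_subfamilies X -> gamma_selections X.
Proof.
move=> Xreg XT1 Xow injx subX C Cmb Ccov.
have /choice[U UP] := fun n => subX (C n) (Cmb n) (Ccov n).
have Umb n k : minimally_bounded (U n k) by apply: (Cmb n); have [+ _] := UP n.
pose D := \bigcup_n \bigcup_k boundary (U n k).
have cD : countable D.
  apply: bigcup_countable => // n _; apply: bigcup_countable => // k _.
  exact: countable_boundary.
have [S exS] := countable_exhaustion cD.
have [|P [oP SP Pv]] := vanishing_neighbourhoods Xreg XT1 subX injx exS.
  by move=> d [n _ [k _ bd]]; exists (U n k).
have [finS mS SD] := exS.
(* This is the intersection of the interiors of [U i k] for [i <= n]. *)
pose V n k := ~` \bigcup_(i in `I_n.+1) closure (~` U i k).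
have oV n k : open (V n k).
  by rewrite openC; apply: closed_bigcup => // i _; exact: closed_closure.
(* Membership in [P n] says nothing about [U i k], so the containment of [S n] is recorded as a
   separate condition. *)
pose Z n := [set A | exists k, (forall i, (i <= n)%N -> S n `<=` U i k) /\
  A = closure (V n k `|` P n)].
have [||n [b [nr Zb bcv]]] := gamma_subfamilies_diagonal (Z := Z) Xreg XT1 subX injx.
- move=> n _ [k [_ ->]]; apply: minimally_bounded_closure; exact: openU.
- move=> F N finF.
  have [N' N'P] := exhaustion_eventually exS (finite_setIl D finF) (@subIsetr _ _ _).
  pose n := maxn N N'; exists n; split; first exact: leq_maxl.
  have [|k kP] := @finite_eventually _ `I_n.+1
      (fun k i => forall y, (F `|` S n) y -> U i k y) (finite_II _).
    move=> i _; apply: finite_eventually; first by rewrite finite_setU.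
    by move=> y _; have [_] := UP i; exact.
  have {}kP i y : (i <= n)%N -> (F `|` S n) y -> U i k y by move=> *; exact: kP.
  exists (closure (V n k `|` P n)).
    by exists k; split=> // i ni y Sy; apply: kP => //; right.
  move=> y Fy; apply: subset_closure.
  have [Dy|nDy] := pselect (D y).
    by right; apply: SP; apply: (N'P n (leq_maxr _ _)).
  left => -[i /= ni]; rewrite closure_setC; apply.
  have [|//|/interior_subset] := @off_boundary _ (U i k) y.
    by move=> bd; apply: nDy; exists i => //; exists k.
  by move=> nU; exfalso; apply: nU; apply: kP => //; left.
have /choice[k kP] := Zb.
exists (fun i => U i (k i)); split.
  by move=> i; have [+ _] := UP i; exact.
move=> y; have [Dy|nDy] := pselect (D y).
  have [_ ->//|N NP] := exhaustion_eventually exS (finite_set1 y).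
  exists N => i Ni; have [kS _] := kP i.
  by apply: (kS i (nr i)); apply: (mS i _ (nr i)); exact: NP.
have [N NP] := bcv y; have [N' N'P] := Pv y nDy.
exists (maxn N N') => i; rewrite geq_max => /andP[Ni N'i].
have [_ bE] := kP i; have := NP i Ni; rewrite bE closureU => -[|]; last first.
  by move=> Py; case: (N'P (n i)) => //; exact: leq_trans (nr i).
(* Since [i <= n i], the stage [n i] involves the family of index [i]. *)
move=> Vy; have Uy : closure (interior (U i (k i))) y.
  apply: closureS Vy => z nz; apply: contrapT => niz; apply: nz.
  by exists i; [exact: nr|rewrite closure_setC].
have [|/interior_subset//|nU] := @off_boundary _ (U i (k i)) y.
  by move=> bd; apply: nDy; exists i => //; exists (k i).
case: (open_closure_disjoint (@open_interior _ _) _ Uy nU).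
by move=> z /interior_subset Uz /interior_subset.
Qed.

(** The set where [B] agrees with [A] need not be minimally bounded. It is replaced by its part in
    the interiors of [A] and of the complement, enlarged by [P n] and regularized; on the boundary,
    agreement is imposed on the finite sets [S n]. *)
Lemma gamma_subfamilies_agreement (X : topologicalType) (x : nat -> X)
    (A : set X) (C : set (set X)) :
  regular_space X -> accessible_space X -> open_whyburn X -> injective x ->
  gamma_subfamilies X -> minimally_bounded A -> C `<=` minimally_bounded ->
  (forall F, finite_set F -> exists2 B, C B & forall y, F y -> (B y <-> A y)) ->
  exists b : nat -> set X, (forall n, C (b n)) /\
    forall y, exists N, forall n, (N <= n)%N -> (b n y <-> A y).
Proof.
move=> Xreg XT1 Xow injx subX Amb Cmb CA.
have [S exS] := countable_exhaustion (countable_boundary Xreg Xow subX Amb).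
have [|P [oP SP Pv]] := vanishing_neighbourhoods Xreg XT1 subX injx exS.
  by move=> d bd; exists A.
have [finS mS SD] := exS.
pose G := interior A; pose H := interior (~` A).
pose E (B : set X) n := (G `&` B) `|` (H `&` ~` B) `|` P n.
have E_int B n : minimally_bounded B -> E B n `<=` closure (interior (E B n)).
  move=> /minimally_boundedP[B1 B2].
  have oG : open G by exact: open_interior.
  have oH : open H by exact: open_interior.
  move=> y [[[Gy /B1/closure_openP By]|[Hy /B2/closure_openP By]]|Py].
  - apply/closure_openP => W oW Wy.
    have [z Bz [Gz Wz]] := By _ (openI oG oW) (conj Gy Wy); exists z => //.
    apply: (sub_interior (openI oG (@open_interior _ B))); last by split.
    by move=> t [Gt /interior_subset Bt]; left; left.
  - apply/closure_openP => W oW Wy.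
    have [z Bz [Hz Wz]] := By _ (openI oH oW) (conj Hy Wy); exists z => //.
    apply: (sub_interior (openI oH (@open_interior _ (~` B)))); last by split.
    by move=> t [Ht /interior_subset Bt]; left; right.
  - by apply: subset_closure; apply: (sub_interior (oP n)) => // t; right.
pose Z n := [set T | exists B, [/\ C B, forall y, S n y -> (B y <-> A y) &
  T = E B n `|` interior (closure (E B n))]].
have [||n [b [nr Zb bcv]]] := gamma_subfamilies_diagonal (Z := Z) Xreg XT1 subX injx.
- move=> n _ [B [CB _ ->]]; apply: minimally_bounded_regularize.
  by apply: E_int; exact: Cmb.
- move=> F N finF.
  have [N' N'P] := exhaustion_eventually exS (finite_setIl (boundary A) finF)
    (@subIsetr _ _ _).
  pose n := maxn N N'; exists n; split; first exact: leq_maxl.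
  have [|B CB BP] := CA (F `|` S n); first by rewrite finite_setU.
  exists (E B n `|` interior (closure (E B n))).
    by exists B; split=> // y Sy; apply: BP; right.
  move=> y Fy; left; have [bd|/off_boundary] := pselect (boundary A y).
    by right; apply: SP; apply: (N'P n (leq_maxr _ _)).
  have BA : B y <-> A y by apply: BP; left.
  move=> [Gy|Hy]; left; [left|right]; split=> //.
    by apply/BA; exact: interior_subset Gy.
  by move=> /BA; exact: interior_subset Hy.
have /choice[B BP] := Zb.
exists B; split; first by move=> i; have [] := BP i.
move=> y; have [bd|nbd] := pselect (boundary A y).
  have [_ ->//|N NP] := exhaustion_eventually exS (finite_set1 y).
  exists N => i Ni; have [_ BA _] := BP i.
  by apply: BA; apply: (mS i _ (nr i)); exact: NP.
have [N NP] := bcv y; have [N' N'P] := Pv y nbd.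
exists (maxn N N') => i; rewrite geq_max => /andP[Ni N'i].
have nP : ~ closure (P (n i)) y by apply: N'P; exact: leq_trans (nr i).
have [CB _ bE] := BP i; have := NP i Ni; rewrite bE => by_.
have Bmb := Cmb _ CB.
have oPc : open (~` closure (P (n i))) by rewrite openC; exact: closed_closure.
have [Gy|Hy] := off_boundary nbd.
  have Ay : A y by exact: interior_subset Gy.
  split=> // _; case: by_ => [[[[]//|[Hy]]|Py]|Iy].
  - by case: (interior_subset Hy).
  - by case: nP; exact: subset_closure.
  (* Here [y] was added by the regularization. Inside [G] and off [closure (P (n i))] the set
     [E (B i) (n i)] lies in [B i], so [W] is an open neighbourhood of [y] inside
     [closure (B i)]. *)
  case: Bmb => _; apply.
  pose W := interior (closure (E (B i) (n i))) `&` (G `&` ~` closure (P (n i))).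
  have oW : open W by apply: openI; [|apply: openI => //]; exact: open_interior.
  apply: (sub_interior oW); last by split.
  move=> z Wz; apply/closure_openP => O oO Oz.
  have [/interior_subset/closure_openP Ez _] := Wz.
  have [t Et [[Wt1 [Gt nPt]] Ot]] := Ez _ (openI oW oO) (conj Wz Oz).
  exists t => //; case: Et => [[[]//|[Ht]]|Pt].
    by case: (interior_subset Ht); exact: interior_subset Gt.
  by case: nPt; exact: subset_closure.
have nAy : ~ A y by exact: interior_subset Hy.
split=> // By; exfalso; case: by_ => [[[[Gy]|[]//]|Py]|Iy].
- by case: nAy; exact: interior_subset Gy.
- by case: nP; exact: subset_closure.
(* The same argument for the complement of [B i], with [H] in place of [G]. *)
case: (minimally_boundedC Bmb) => _ BC; suff : (~` B i) y by [].
apply: BC.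
pose W := interior (closure (E (B i) (n i))) `&` (H `&` ~` closure (P (n i))).
have oW : open W by apply: openI; [|apply: openI => //]; exact: open_interior.
apply: (sub_interior oW); last by split.
move=> z Wz; apply/closure_openP => O oO Oz.
have [/interior_subset/closure_openP Ez _] := Wz.
have [t Et [[Wt1 [Ht nPt]] Ot]] := Ez _ (openI oW oO) (conj Wz Oz).
exists t => //; case: Et => [[[Gt]|[]//]|Pt].
  by case: (interior_subset Ht); exact: interior_subset Gt.
by case: nPt; exact: subset_closure.
Qed.

(** * Frechet-Urysohn properties of [Qp] *)

Lemma quasicontinuous_sub (X : topologicalType) (R : realType) (a f : X -> R) :
  quasicontinuous a -> continuous f -> quasicontinuous (fun x => a x - f x).
Proof.
move=> qa cf x V U oV Vx oU Ux.
have /= [[P Q] [nP nQ] PQV] :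
    nbhs (a x, f x) ((fun p : R * R => p.1 - p.2) @^-1` V).
  have sub_cts : {for (a x, f x), continuous (fun p : R * R => p.1 - p.2)}.
    by apply: cvgB; [exact: cvg_fst|exact: cvg_snd].
  by apply: sub_cts; exact: open_nbhs_nbhs.
(* Continuity of [f] first shrinks [U]; quasicontinuity of [a] is then applied inside the smaller
   open set. *)
have [||||W [oW W0 WU WP]] := qa x (interior P) (U `&` f @^-1` (interior Q)).
- exact: open_interior.
- exact: nP.
- apply: openI => //; apply: open_comp => [? _|]; first exact: cf.
  exact: open_interior.
- by split; [|exact: nQ].
exists W; split=> //; first by move=> y /WU[].
move=> _ [y Wy <-]; apply: (PQV (a y, f y)); split=> /=.
  by apply: interior_subset; apply: WP; exists y.
by have [_ /interior_subset] := WU y Wy.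
Qed.

(** The strict sublevel set is regularized. A point with [e < |g x|] is never added: an open set on
    which [e < |g|] would lie in the closure of the sublevel set and hence meet it. *)
Lemma quasicontinuous_small_set (X : topologicalType) (R : realType) (g : X -> R)
    (e : R) : quasicontinuous g ->
  exists2 B, minimally_bounded B &
    [set x | `|g x| < e] `<=` B /\ B `<=` [set x | `|g x| <= e].
Proof.
move=> qg; set E := [set x | `|g x| < e].
have oV : open [set t : R | `|t| < e].
  by apply: (@open_comp _ _ (fun t : R => `|t|) [set t | t < e]) => [t _|];
    [exact: norm_continuous|exact: open_lt].
have oV' : open [set t : R | e < `|t|].
  by apply: (@open_comp _ _ (fun t : R => `|t|) [set t | e < t]) => [t _|];
    [exact: norm_continuous|exact: open_gt].
exists (E `|` interior (closure E)).
  apply: minimally_bounded_regularize => x Ex; apply/closure_openP => U oU Ux.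
  have [W [oW [y Wy] WU WV]] := qg x _ U oV Ex oU Ux.
  exists y; last exact: WU.
  by apply: (sub_interior oW) => // z Wz; apply: (WV (g z)); exists z.
split=> [x|x [/ltW//|Ix]]; first by left.
rewrite /= leNgt; apply/negP => xe.
have [W [oW [y Wy] WU WV]] := qg x _ _ oV' xe (@open_interior _ _) Ix.
have /interior_subset/closure_openP/(_ W oW Wy)[z Ez Wz] := WU y Wy.
have /= : e < `|g z| by apply: (WV (g z)); exists z.
by rewrite ltNge (ltW Ez).
Qed.

Lemma Qp_lift (X Y : topologicalType) (f : X -> Y) :
  quasicontinuous f -> exists a : Qp X Y, (set_val a : X -> Y) = f.
Proof. by move=> qf; exists (SigSub (mem_set (qf : Qset X Y f))). Qed.

Lemma Qp_quasicontinuous (X Y : topologicalType) (a : Qp X Y) :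
  quasicontinuous (set_val a : X -> Y).
Proof. exact: (set_valP a). Qed.

(** The tolerance shrinks with [n], hence one family per [n]. Continuity of [f] makes the
    differences [g a] quasicontinuous. *)
Lemma gamma_selections_frechet_urysohn (X : topologicalType) (R : realType) :
  gamma_selections X -> forall f : Qp X R,
  continuous (set_val f : X -> R) -> frechet_urysohn_at f.
Proof.
move=> selX f cf A clA.
pose g (a : Qp X R) x : R := (set_val a : X -> R) x - (set_val f : X -> R) x.
have qg a : quasicontinuous (g a).
  by apply: quasicontinuous_sub => //; exact: Qp_quasicontinuous.
pose C n := [set B : set X | minimally_bounded B /\ exists2 a, A a &
  B `<=` [set x | `|g a x| <= n.+1%:R^-1]].
have [||b [Cb bcv]] := selX C.
- by move=> n B [].
- move=> n F finF.
  have [] := (Qp_closureP A f).1 clA F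
    (fun x => [set t : R | `|t - (set_val f : X -> R) x| < n.+1%:R^-1]) finF.
    move=> x; have : nbhs ((set_val f : X -> R) x)
        (ball ((set_val f : X -> R) x) n.+1%:R^-1) by exact: nbhsx_ballx.
    by apply: filterS => t; rewrite /ball /= distrC.
  move=> a Aa aF; have [B Bmb [B1 B2]] := quasicontinuous_small_set n.+1%:R^-1 (qg a).
  by exists B; [split=> //; exists a|move=> x Fx; apply: B1; exact: aF].
have /choice[u uP] : forall n, exists a, A a /\
    b n `<=` [set x | `|g a x| <= n.+1%:R^-1].
  by move=> n; have [_ [a ? ?]] := Cb n; exists a.
exists u; split; first by move=> n; have [] := uP n.
apply/Qp_cvgP => x; apply/cvgrPdist_le => e e0.
have [N NP] := bcv x.
near=> n; rewrite distrC.
have : `|g (u n) x| <= n.+1%:R^-1.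
  have [_ ] := uP n; apply; apply: NP; near: n; exact: nbhs_infty_ge.
move/le_trans; apply; apply: ltW; near: n; exact: near_infty_natSinv_lt (PosNum e0).
Unshelve. all: by end_near. Qed.

(** Functions equal to [y0] on [B] and [y1] off [B] approximate the constant [y0] on each finite
    subset of [B]; as [V] excludes [y1], convergence becomes eventual membership. Real and boolean
    values are covered together. *)
Lemma frechet_urysohn_gamma_subfamilies (X Y : topologicalType) (y0 y1 : Y)
    (z : Qp X Y) :
  (exists2 V, nbhs y0 V & ~ V y1) -> (set_val z : X -> Y) = (fun=> y0) ->
  frechet_urysohn_at z -> gamma_subfamilies X.
Proof.
move=> [V nV Vy1] zE fuz C Cmb Ccov.
pose ind (B : set X) x := if x \in B then y0 else y1.
have qind B : minimally_bounded B -> quasicontinuous (ind B).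
  move=> /minimally_bounded_indicator qB x V' U _ V'x oU Ux.
  have [W [oW W0 WU WV]] := qB x [set x \in B] U (discrete_open _) erefl oU Ux.
  exists W; split=> // _ [t Wt <-].
  have /= tx : [set x \in B] (t \in B) by apply: WV; exists t.
  by rewrite /ind tx.
have [|u [Au uz]] := fuz [set a | exists2 B, C B & (set_val a : X -> Y) = ind B].
  apply/Qp_closureP => F W finF nW; have [B CB FB] := Ccov F finF.
  have [a aE] := Qp_lift (qind B (Cmb B CB)).
  exists a; first by exists B.
  move=> x Fx; rewrite aE /ind mem_set; last exact: FB.
  by have := nbhs_singleton (nW x); rewrite zE.
have /choice[b bP] : forall n, exists B, C B /\ (set_val (u n) : X -> Y) = ind B.
  by move=> n; have [B ? ?] := Au n; exists B.
exists b; split; first by move=> n; have [] := bP n.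
move=> x; move/Qp_cvgP/(_ x): uz; rewrite zE => /(_ V nV)[N _ NP].
exists N => n Nn; apply: contrapT => nb; have := NP n Nn.
by have [_ /= ->] := bP n; rewrite /ind memNset.
Qed.

(** Elements of [Qp X bool] are indicators of minimally bounded sets, and pointwise convergence is
    eventual agreement at each point. *)
Lemma gamma_subfamilies_frechet_urysohn_bool (X : topologicalType) (x : nat -> X) :
  regular_space X -> accessible_space X -> open_whyburn X -> injective x ->
  gamma_subfamilies X -> frechet_urysohn (Qp X bool).
Proof.
move=> Xreg XT1 Xow injx subX z A clA.
pose pos (a : Qp X bool) := [set y : X | (set_val a : X -> bool) y].
have mbpos a : minimally_bounded (pos a).
  apply/minimally_bounded_indicator.
  have -> : (fun y => y \in pos a) = set_val a.
    by apply/funext => y; apply/idP/idP => [/set_mem|/mem_set].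
  exact: Qp_quasicontinuous.
have [|F finF|b [Cb bcv]] := @gamma_subfamilies_agreement _ x (pos z) [set pos a | a in A]
    Xreg XT1 Xow injx subX (mbpos z).
- by move=> _ [a _ <-].
- have [|a Aa aF] := (Qp_closureP A z).1 clA F (fun y => [set (set_val z : X -> bool) y]) finF.
    by move=> y; apply: open_nbhs_nbhs; split=> //; exact: discrete_open.
  exists (pos a); first by exists a.
  by move=> y Fy; rewrite /pos /= (aF y Fy).
have /choice[u uP] : forall n, exists a, A a /\ pos a = b n.
  by move=> n; have [a ? ?] := Cb n; exists a.
exists u; split; first by move=> n; have [] := uP n.
apply/Qp_cvgP => y V nV; have [N NP] := bcv y.
exists N => // n Nn; have := NP n Nn; have [_ <-] := uP n => pE.
suff uz : (set_val (u n) : X -> bool) y = (set_val z : X -> bool) y.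
  by rewrite /= uz; exact: nbhs_singleton.
by apply/idP/idP => /pE.
Qed.

(** * Selection principles for covers *)

Lemma converges_to_total_gamma_cover (X : Type) (b : nat -> set X) :
  converges_to_total b -> gamma_cover (range b).
Proof.
move=> bcv; split.
  apply/seteqP; split=> // y _; have [N NP] := bcv y.
  by exists (b N); [exists N|exact: NP].
move=> y; have [N NP] := bcv y; apply: (@sub_finite_set _ _ (b @` `I_N)).
  move=> _ [[n _ <-] nb]; exists n => //=; rewrite ltnNge.
  by apply/negP => /NP.
by apply: finite_image; exact: finite_II.
Qed.

(* A set omitted by x m can only occur among the b n with n <= m, so b takes
   each value finitely often. *)
Lemma gamma_cover_converges_to_total (X : Type) (x : nat -> X) (b : nat -> set X) :
  (forall n i, (i < n)%N -> b n (x i)) -> (forall n, exists m, ~ b n (x m)) ->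
  gamma_cover (range b) -> converges_to_total b.
Proof.
move=> bx bnx [_ bfin] y.
have [_ [[k _ <-] _]|N NP] := @finite_eventually _ _ (fun n A => b n <> A) (bfin y).
  have [m bm] := bnx k; exists m.+1 => n mn bnk.
  by apply: bm; rewrite -bnk; exact: bx.
exists N => n Nn; apply: contrapT => nb.
by apply: (NP n Nn (b n)) => //; split=> //; exists n.
Qed.

Lemma gamma_selections_S1_Omega_s (X : topologicalType) :
  gamma_selections X -> S1 (Omega_s X) (Gamma_s X).
Proof.
move=> selX s sO; have [||b [sb bcv]] := selX s.
- by move=> n U sU; have [_] := sO n; apply.
- by move=> n; have [[_ +] _] := sO n.
exists b; split=> //; split; first exact: converges_to_total_gamma_cover.
by move=> _ [n _ <-]; have [_] := sO n; apply; exact: sb.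
Qed.

Lemma gamma_selections_S1_K_Omega (X : topologicalType) :
  gamma_selections X -> S1 (K_Omega X) (K_Gamma X).
Proof.
move=> selX s sK; have [||b [sb bcv]] := selX (fun n => closure @` s n).
- move=> n _ [U sU <-]; apply: minimally_bounded_closure.
  by have [[+ _] _ _] := sK n; apply.
- move=> n F /(fun h => let: And3 _ _ k := sK n in k F h)[U sU FU].
  by exists (closure U) => //; exists U.
have /choice[U UP] : forall n, exists U, s n U /\ closure U = b n.
  by move=> n; have [U ? ?] := sb n; exists U.
have UE : (fun n => closure (U n)) = b by apply/funext => n; have [] := UP n.
exists U; split; first by move=> n; have [] := UP n.
have gU : gamma_cover (closure @` range U).
  by rewrite image_comp [_ \o _]UE; exact: converges_to_total_gamma_cover.
split=> //.
- split; first by move=> _ [n _ <-]; have [[+ _] _ _] := sK n; apply; have [] := UP n.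
  by case: gU => + _; rewrite /is_cover bigcup_image.
- by move=> _ [n _ <-]; have [_ + _] := sK n; apply; have [] := UP n.
Qed.

(** The range of a selection does not record repetitions. The points [x i] inside and [x m] outside
    limit how often a selected set can recur; the omission comes from removing a closed
    neighbourhood of [x m]. *)
Lemma marked_member (X : topologicalType) (x : nat -> X) (C : set (set X))
    (F : set X) (n : nat) :
  regular_space X -> accessible_space X -> injective x ->
  C `<=` minimally_bounded -> finitely_covers C -> finite_set F ->
  exists A U m, [/\ minimally_bounded A, C U, A `<=` U,
    F `<=` A /\ (forall i, (i < n)%N -> A (x i)) & ~ A (x m)].
Proof.
move=> Xreg XT1 injx Cmb Ccov finF.
have finF' : finite_set (F `|` x @` `I_n).
  by rewrite finite_setU; split=> //; apply: finite_image; exact: finite_II.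
have [N /(_ N (leqnn N)) Nx] := injective_avoids injx finF'.
have [ O [oO Ox OF]] := regular_open_finite Xreg XT1 finF' Nx.
have [U CU FU] := Ccov _ finF'.
exists (U `\` closure O), U, N; split=> //.
- by apply: minimally_boundedD => //; exact: Cmb.
- split=> [y Fy|i ni].
    by split; [apply: FU; left|apply: OF; left].
  by split; [apply: FU|apply: OF]; right; exists i.
- by move=> [_]; apply; exact: subset_closure.
Qed.

Lemma S1_Omega_s_gamma_subfamilies (X : topologicalType) (x : nat -> X) :
  regular_space X -> accessible_space X -> injective x ->
  S1 (Omega_s X) (Gamma_s X) -> gamma_subfamilies X.
Proof.
move=> Xreg XT1 injx s1 C Cmb Ccov.
(* Members of [s n] are marked subsets of members of [C]; eventual membership passes from them to
   the larger sets [U]. *)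
pose s n := [set A | minimally_bounded A /\ exists U m, [/\ C U, A `<=` U,
  forall i, (i < n)%N -> A (x i) & ~ A (x m)]].
have scov n : finitely_covers (s n).
  move=> F finF.
  have [A [U [m [? ? ? [? ?] ?]]]] := marked_member n Xreg XT1 injx Cmb Ccov finF.
  by exists A => //; split=> //; exists U, m.
have [|b [sb [bg _]]] := s1 s.
  move=> n; split; last by move=> A [].
  split; last exact: scov.
  apply/seteqP; split=> // y _.
  by have [A sA Ay] := scov n [set y] (finite_set1 y); exists A => //; exact: Ay.
have /choice[U UP] : forall n, exists U, C U /\ b n `<=` U.
  by move=> n; have [_ [U [m [? ? _ _]]]] := sb n; exists U.
have bcv : converges_to_total b.
  apply: (gamma_cover_converges_to_total (x := x)) => // n.
    by have [_ [? [m []]]] := sb n.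
  by have [_ [? [m []]]] := sb n; exists m.
exists U; split; first by move=> n; have [] := UP n.
by move=> y; have [N NP] := bcv y; exists N => n /NP; have [_] := UP n; apply.
Qed.

Lemma S1_K_Omega_gamma_subfamilies (X : topologicalType) (x : nat -> X) :
  regular_space X -> accessible_space X -> open_whyburn X -> injective x ->
  S1 (K_Omega X) (K_Gamma X) -> gamma_subfamilies X.
Proof.
move=> Xreg XT1 Xow injx s1 C Cmb Ccov.
pose s n := [set V | open V /\ exists U m, [/\ C U, closure V `<=` U,
  forall i, (i < n)%N -> closure V (x i) & ~ closure V (x m)]].
have scov n F : finite_set F -> exists2 V, s n V & F `<=` closure V.
  move=> finF.
  have [A [U [m [Amb CU AU [FA xA] nA]]]] :=
    marked_member n Xreg XT1 injx Cmb Ccov finF.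
  pose F' := F `|` x @` `I_n.
  have finF' : finite_set F'.
    by rewrite finite_setU; split=> //; apply: finite_image; exact: finite_II.
  have F'A : F' `<=` A by move=> y [/FA//|[i ni <-]]; exact: xA.
  (* Points of [F'] lie in [A] but perhaps not in its interior; [closure V] still stays inside [A],
     so it keeps omitting [x m]. *)
  have [|V [oV VA FV VAF]] := open_whyburn_finite Xreg Xow (@open_interior _ A) finF'.
    by apply: (subset_trans F'A); case: Amb.
  have VA' : closure V `<=` A by move=> y /VAF[/interior_subset|/F'A].
  exists V; last by move=> y Fy; apply: FV; left.
  split=> //; exists U, m; split=> //.
  - exact: subset_trans AU.
  - by move=> i ni; apply: FV; right; exists i.
  - by move=> /VA'.
have [|b [sb [_ _ bg]]] := s1 s.
  move=> n; split; last exact: scov.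
  - split; first by move=> V [].
    apply/seteqP; split=> // y _.
    by have [V sV Vy] := scov n [set y] (finite_set1 y); exists V => //; exact: Vy.
  (* The omitted point [x m] shows that [V] is not dense. *)
  - by move=> V [_ [U [m [_ _ _ +]]]]; apply: contra_not => ->.
have /choice[U UP] : forall n, exists U, C U /\ closure (b n) `<=` U.
  by move=> n; have [_ [U [m [? ? _ _]]]] := sb n; exists U.
have bcv : converges_to_total (fun n => closure (b n)).
  apply: (gamma_cover_converges_to_total (x := x)) => [n|n|].
  - by have [_ [? [m []]]] := sb n.
  - by have [_ [? [m []]]] := sb n; exists m.
  - by rewrite image_comp in bg.
exists U; split; first by move=> n; have [] := UP n.
by move=> y; have [N NP] := bcv y; exists N => n /NP; have [_] := UP n; apply.
Qed.

Unset Implicit Arguments.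

Theorem theorem7p1 (R : realType) (X : topologicalType)
  (Xreg : regular_space X) (XT1 : accessible_space X)
  (Xunc : ~ countable [set: X]) (Xow : open_whyburn X) :
  [/\ (S1 (Omega_s X) (Gamma_s X) <-> S1 (K_Omega X) (K_Gamma X)),
      (S1 (K_Omega X) (K_Gamma X) <->
        (forall z : Qp X R, set_val z = (fun _ => 0 : R) -> frechet_urysohn_at z)),
      ((forall z : Qp X R, set_val z = (fun _ => 0 : R) -> frechet_urysohn_at z) <->
        (forall f : Qp X R, continuous (set_val f : X -> R) -> frechet_urysohn_at f)) &
      ((forall f : Qp X R, continuous (set_val f : X -> R) -> frechet_urysohn_at f) <->
        frechet_urysohn (Qp X bool))].
Proof.
have [x injx] := infinite_sequence Xunc.
set P1 := S1 _ _; set P2 := S1 _ _; set P3 := forall z : Qp X R, set_val z = _ -> _.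
set P4 := forall f : Qp X R, _; set P5 := frechet_urysohn _.
have W1 : gamma_subfamilies X <-> P1.
  split=> [/(gamma_subfamilies_selections Xreg XT1 Xow injx)|].
    exact: gamma_selections_S1_Omega_s.
  exact: S1_Omega_s_gamma_subfamilies injx.
have W2 : gamma_subfamilies X <-> P2.
  split=> [/(gamma_subfamilies_selections Xreg XT1 Xow injx)|].
    exact: gamma_selections_S1_K_Omega.
  exact: S1_K_Omega_gamma_subfamilies injx.
have WP4 : gamma_subfamilies X -> P4.
  move=> /(gamma_subfamilies_selections Xreg XT1 Xow injx).
  exact: gamma_selections_frechet_urysohn.
have P43 : P4 -> P3.
  by move=> h z zE; apply: h; rewrite zE => t; exact: cvg_cst.
have qcst (Y : topologicalType) (y : Y) : quasicontinuous (fun _ : X => y).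
  by move=> t V U _ Vy oU Ut; exists U; split=> //; [exists t|move=> _ [? _ <-]].
have P3W : P3 -> gamma_subfamilies X.
  have [z zE] := Qp_lift (qcst R 0); move=> /(_ z zE).
  apply: (@frechet_urysohn_gamma_subfamilies X R 0 1 z _ zE).
  exists (ball (0 : R) 1); first exact: nbhsx_ballx.
  by rewrite /ball /= sub0r normrN normr1 ltxx.
have P5W : P5 -> gamma_subfamilies X.
  have [z zE] := Qp_lift (qcst bool true); move=> /(_ z).
  apply: (@frechet_urysohn_gamma_subfamilies X bool true false z _ zE).
  by exists [set true] => //; apply: open_nbhs_nbhs; split=> //; exact: discrete_open.
have WP5 : gamma_subfamilies X -> P5.
  exact: gamma_subfamilies_frechet_urysohn_bool injx.
(* [gamma_subfamilies X] implies [P4], which implies [P3], which leads back to it; [P1], [P2] and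
   [P5] are each equivalent to it. *)
by split; tauto.
Qed.
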